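(* Let $n>2$ be odd and let $K$ be a field containing a primitive $m$-th root of unity for every odd $m\le n$. Then $\mathrm{OBC}_n(K)$ fails: there do not exist functions $f_1,\ldots,f_n$, where $f_i$ assigns a permutation $\pi_i=f_i(B_1,\ldots,B_i)\in S_n$ to every $i$-tuple $(B_1,\ldots,B_i)$ of ordered bases of $K^n$, such that for every sequence $B_1,\ldots,B_n$ of ordered bases of $K^n$, writing $B_i=(v_{i,1},\ldots,v_{i,n})$ and $\pi_i=f_i(B_1,\ldots,B_i)$, for each $j=1,\ldots,n$ the vectors $v_{1,\pi_1(j)},\ldots,v_{n,\pi_n(j)}$ form a basis of $K^n$.
   Context: $\mathrm{OBC}_n(K)$ (online version of Rota's basis conjecture) is the statement that $n$ bases of $K^n$ can be arranged as rows of an $n\times n$ array, each row's permutation being chosen immediately after that row is read and without knowledge of later rows, so that all columns of the resulting array are bases of $K^n$; the claim spells this out formally. *)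

(* Defs.v *)
From mathcomp Require Import all_boot all_fingroup all_algebra.

Set Implicit Arguments.
Unset Strict Implicit.
Unset Printing Implicit Defensive.

Import GRing.Theory.
Local Open Scope ring_scope.

Definition ordered_basis (K : fieldType) (n : nat) : Type :=
  {B : n.-tuple 'rV[K]_n | basis_of fullv B}.

Definition basis_vec (K : fieldType) (n : nat) (B : ordered_basis K n)
    (j : 'I_n) : 'rV[K]_n :=
  tnth (val B) j.

(* The index i : 'I_n is 0-based, so the tuple (B_1, ..., B_i) of the usual
   1-based numbering has length i.+1 here; ltn_ord i proves i.+1 <= n. *)
Definition prefix_upto (T : Type) (n : nat) (B : 'I_n -> T) (i : 'I_n) :
    i.+1.-tuple T :=
  [tuple B (widen_ord (ltn_ord i) k) | k < i.+1].

Definition OBC (K : fieldType) (n : nat) : Prop :=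
  exists f : forall i : 'I_n, i.+1.-tuple (ordered_basis K n) -> 'S_n,
  forall (B : 'I_n -> ordered_basis K n) (j : 'I_n),
    basis_of fullv
      [tuple basis_vec (B i) (f i (prefix_upto B i) j) | i < n].

(* Main.v *)
(* The adversary plays the standard basis in the first n - 2 rows. If it went on
   doing so, the strategy would produce a Latin square; let alpha and beta be its
   last two rows, so that column j lacks exactly alpha j and beta j after n - 2
   rows. As n is odd, rho = beta o alpha^-1 has an orbit O of odd size m. Row
   n - 1 is then the basis F with the discrete Fourier basis on O and e_a for a
   outside O. A column with alpha j = b in O has to receive an F_a with a in O,
   and the hyperplane it then spans is w(rho b) = z^(index of a) w(b), z being a
   primitive m-th root of unity. Around O the factors multiply to
   z^(0 + ... + (m - 1)) = 1 because m is odd, so some w with w(x) = 1, x in O,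
   lies in all these hyperplanes. In the last row the adversary replaces e_x by w
   in the standard basis: only the m - 1 vectors e_c, c in O \ {x}, avoid some of
   the m hyperplanes, so some column is degenerate. *)
Require Import Defs.
From mathcomp Require Import all_boot all_fingroup all_algebra.

Set Implicit Arguments.
Unset Strict Implicit.
Unset Printing Implicit Defensive.

Import GRing.Theory.
Local Open Scope ring_scope.

(** Replies depend only on the rows read so far, so two adversaries that agree up to row [i] get the
    same permutation there. *)
Lemma eq_prefix_upto (T : Type) (n : nat) (B B' : 'I_n -> T) (i : 'I_n) :
  (forall k : 'I_n, (k <= i)%N -> B k = B' k) ->
  prefix_upto B i = prefix_upto B' i.
Proof.
move=> eqB; apply: eq_from_tnth => k; rewrite !tnth_mktuple.
by apply: eqB; rewrite /= -ltnS.
Qed.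

(** * Bases and invertible matrices *)

Lemma basis_of_rows (K : fieldType) (n : nat) (M : 'M[K]_n) :
  M \in unitmx -> basis_of fullv [tuple row i M | i < n].
Proof.
move=> uM; rewrite basisEfree subvf size_tuple dimvf /dim /= mul1n leqnn !andbT.
apply/(@freeP _ _ n [tuple row i M | i < n]) => k sum0 i.
have : (\row_j k j) *m M = 0.
  rewrite mulmx_sum_row -[RHS]sum0; apply: eq_bigr => j _.
  by rewrite mxE -tnth_nth tnth_mktuple.
move/(congr1 (mulmx^~ (invmx M))); rewrite mulmxK // mul0mx.
by move/rowP/(_ i); rewrite !mxE.
Qed.

Definition basis_of_unitmx (K : fieldType) (n : nat) (M : 'M[K]_n)
    (uM : M \in unitmx) : ordered_basis K n :=
  exist _ [tuple row i M | i < n] (basis_of_rows uM).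

Lemma basis_vec_unitmx (K : fieldType) (n : nat) (M : 'M[K]_n)
    (uM : M \in unitmx) (j : 'I_n) :
  basis_vec (basis_of_unitmx uM) j = row j M.
Proof. by rewrite /basis_vec tnth_mktuple. Qed.

Lemma basis_annihilator (K : fieldType) (n : nat) (X : n.-tuple 'rV[K]_n)
    (h : 'cV[K]_n) :
  basis_of fullv X -> (forall i, tnth X i *m h = 0) -> h = 0.
Proof.
move=> bX Xh0; rewrite -[h]mul1mx; apply/row_matrixP => i.
rewrite row_mul row0 (coord_basis bX (memvf (row i 1%:M))) mulmx_suml.
by rewrite big1 // => j _; rewrite -scalemxAl -tnth_nth Xh0 scaler0.
Qed.

Lemma unitmx_annihilator (K : fieldType) (n : nat) (M : 'M[K]_n) :
  (forall h : 'cV_n, M *m h = 0 -> h = 0) -> M \in unitmx.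
Proof.
move=> injM; rewrite -unitmx_tr -row_free_unit; apply: inj_row_free => v vM0.
by rewrite -[v]trmxK (injM v^T) ?trmx0 // -[M]trmxK -trmx_mul vM0 trmx0.
Qed.

(** * Orbits of a permutation *)

(** The orbits partition [T]; if all were even, so would be [#|T|]. *)
Lemma odd_porbit_exists (T : finType) (s : {perm T}) :
  odd #|T| -> exists x, odd #|porbit s x|.
Proof.
move=> oddT; apply/existsP; apply: contraLR oddT => /existsPn evO.
rewrite -cardsT -sum1_card (partition_big_imset (porbit s)) /=.
rewrite -dvdn2; apply: dvdn_sum => _ /imsetP[y _ ->].
rewrite sum1_card (_ : #|_| = #|porbit s y|) ?dvdn2 //.
by apply: eq_card => z; rewrite [LHS]unfold_in /= inE eq_porbit_mem.
Qed.

(** The discrete logarithm along the cycle started at [x]; meaningful only for [a] in the orbit. *)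
Definition orbit_index (T : finType) (s : {perm T}) (x a : T) : nat :=
  index a (traject s x #|porbit s x|).

Lemma orbit_index_lt (T : finType) (s : {perm T}) (x a : T) :
  a \in porbit s x -> (orbit_index s x a < #|porbit s x|)%N.
Proof. by rewrite porbit_traject -index_mem size_traject. Qed.

Lemma iter_orbit_index (T : finType) (s : {perm T}) (x a : T) :
  a \in porbit s x -> iter (orbit_index s x a) s x = a.
Proof.
move=> aO; rewrite -(nth_traject s (orbit_index_lt aO)) nth_index //.
by rewrite -porbit_traject.
Qed.

Lemma orbit_index_iter (T : finType) (s : {perm T}) (x : T) (i : nat) :
  (i < #|porbit s x|)%N -> orbit_index s x (iter i s x) = i.
Proof.
move=> im; rewrite /orbit_index -(nth_traject s im) index_uniq ?size_traject //.
exact: uniq_traject_porbit.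
Qed.

Lemma iter_in_porbit (T : finType) (s : {perm T}) (x : T) (i : nat) :
  iter i s x \in porbit s x.
Proof. by rewrite -permX mem_porbit. Qed.

Lemma orbit_indexS (T : finType) (s : {perm T}) (x b : T) :
  b \in porbit s x ->
  orbit_index s x (s b) = ((orbit_index s x b).+1 %% #|porbit s x|)%N.
Proof.
move=> bO; rewrite -{1}(iter_orbit_index bO) -iterS.
have := orbit_index_lt bO; rewrite leq_eqVlt => /orP[/eqP eqm|ltm].
  rewrite eqm iter_porbit modnn -[x in LHS]/(iter 0 s x) orbit_index_iter //.
  by rewrite -eqm.
by rewrite orbit_index_iter // modn_small.
Qed.

Lemma big_porbit (R : Type) (idx : R) (op : Monoid.com_law idx) (T : finType)
    (s : {perm T}) (x : T) (F : T -> R) :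
  \big[op/idx]_(b in porbit s x) F b =
  \big[op/idx]_(i < #|porbit s x|) F (iter i s x).
Proof.
rewrite (eq_bigl _ _ (porbit_traject s x)) -big_uniq ?uniq_traject_porbit //.
rewrite (big_nth x) size_traject big_mkord.
by apply: eq_bigr => i _; rewrite nth_traject.
Qed.

(** [g] permutes the orbit, so the sum is 0 + ... + (m - 1) = m (m - 1) / 2, with m - 1 even. *)
Lemma odd_dvdn_sum_orbit_index (T : finType) (s : {perm T}) (x : T)
    (g : T -> T) :
  odd #|porbit s x| -> injective g ->
  (forall b, b \in porbit s x -> g b \in porbit s x) ->
  (#|porbit s x| %| \sum_(i < #|porbit s x|) orbit_index s x (g (iter i s x)))%N.
Proof.
move=> odd_m g_inj gO; rewrite -(big_porbit _ s x (orbit_index s x \o g)) /=.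
have gO_eq : g @: porbit s x = porbit s x.
  apply/eqP; rewrite eqEcard card_imset // leqnn andbT.
  by apply/subsetP => _ /imsetP[b /gO ? ->].
rewrite -(big_imset (orbit_index s x)) /=; last by move=> ? ? _ _ /g_inj.
rewrite gO_eq big_porbit.
under eq_bigr => i _ do rewrite orbit_index_iter //.
by rewrite -(big_mkord xpredT id) bin2_sum bin2odd // dvdn_mulr.
Qed.

(** * The two special rows of the adversary *)

Definition orbit_fourier (K : fieldType) (n : nat) (s : 'S_n) (x : 'I_n)
    (z : K) : 'M[K]_n :=
  \matrix_(a, b)
    if a \in porbit s x then
      if b \in porbit s x then z ^+ (orbit_index s x a * orbit_index s x b)
      else 0
    else (a == b)%:R.

(** Vandermonde argument: a kernel vector vanishes off the orbit, and its entries along the orbit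
    are the coefficients of a polynomial of degree below m with the m distinct roots [z ^+ k]. *)
Lemma orbit_fourier_unitmx (K : fieldType) (n : nat) (s : 'S_n) (x : 'I_n)
    (z : K) :
  #|porbit s x|.-primitive_root z -> orbit_fourier s x z \in unitmx.
Proof.
set m := #|_| => z_prim; apply: unitmx_annihilator => h Mh0.
have h_out a : a \notin porbit s x -> h a 0 = 0.
  move=> aNO; move/matrixP/(_ a 0): Mh0; rewrite !mxE (bigD1 a) //= mxE.
  rewrite (negPf aNO) eqxx mul1r big1 ?addr0 // => b bNa.
  by rewrite mxE (negPf aNO) eq_sym (negPf bNa) mul0r.
pose p := \poly_(i < m) h (iter i s x) 0.
have p_root k : (k < m)%N -> root p (z ^+ k).
  move=> km; rewrite /root horner_poly.
  move/matrixP/(_ (iter k s x) 0): Mh0; rewrite !mxE => Mh_k0.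
  apply/eqP; rewrite -[RHS]Mh_k0 [RHS](bigID (mem (porbit s x))) /=.
  rewrite [X in _ + X]big1 ?addr0; last first.
    by move=> b /h_out->; rewrite mulr0.
  rewrite big_porbit; apply: eq_bigr => i _.
  by rewrite mxE !iter_in_porbit !orbit_index_iter // -exprM mulrC.
have p0 : p = 0.
  apply: (@roots_geq_poly_eq0 _ _ [seq z ^+ i | i <- iota 0 m]).
  - apply/allP => y /mapP[i]; rewrite mem_iota => /andP[_ im] ->.
    exact: p_root.
  - rewrite map_inj_in_uniq ?iota_uniq // => i j; rewrite !mem_iota /= !add0n.
    move=> im jm /eqP; rewrite (eq_prim_root_expr z_prim).
    by rewrite !modn_small // => /eqP.
  - by rewrite size_map size_iota size_poly.
apply/colP => a; rewrite mxE.
have [aO|/h_out//] := boolP (a \in porbit s x).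
have := coef_poly m (fun i => h (iter i s x) 0) (orbit_index s x a).
by rewrite -/p p0 coef0 orbit_index_lt // iter_orbit_index.
Qed.

(** Solve the recurrence step by step from [x], accumulating exponents in [E]; it closes up after m
    steps because m divides [E m]. *)
Lemma orbit_recurrence_solution (K : fieldType) (n : nat) (s : 'S_n)
    (x : 'I_n) (z : K) (g : 'I_n -> 'I_n) :
  odd #|porbit s x| -> z ^+ #|porbit s x| = 1 -> injective g ->
  (forall b, b \in porbit s x -> g b \in porbit s x) ->
  exists w : 'rV[K]_n, w 0 x = 1 /\
    forall b, b \in porbit s x ->
      w 0 (s b) = z ^+ orbit_index s x (g b) * w 0 b.
Proof.
move=> odd_m zm1 g_inj gO.
pose E i := (\sum_(l < i) orbit_index s x (g (iter l s x)))%N.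
have zE_m : z ^+ E #|porbit s x| = 1.
  rewrite /E; have /dvdnP[q ->] := odd_dvdn_sum_orbit_index odd_m g_inj gO.
  by rewrite mulnC exprM zm1 expr1n.
have m_gt0 : (0 < #|porbit s x|)%N by rewrite odd_gt0.
exists (\row_c z ^+ E (orbit_index s x c)); split.
  rewrite mxE -[x in orbit_index s x x]/(iter 0 s x) orbit_index_iter //.
  by rewrite /E big_ord0.
move=> b bO; rewrite !mxE -exprD orbit_indexS //.
set k := orbit_index s x b.
have -> : (orbit_index s x (g b) + E k = E k.+1)%N.
  by rewrite /E big_ord_recr /= addnC iter_orbit_index.
(* Wrap-around: the last point of the cycle is sent back to [x], of index 0. *)
have := orbit_index_lt bO; rewrite leq_eqVlt -/k => /orP[/eqP->|k_lt].
  by rewrite modnn {1}/E big_ord0 zE_m.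
by rewrite modn_small.
Qed.

Definition replace_row1 (K : fieldType) (n : nat) (x : 'I_n) (w : 'rV[K]_n) :
    'M[K]_n :=
  \matrix_a (if a == x then w else delta_mx 0 a).

Lemma replace_row1_unitmx (K : fieldType) (n : nat) (x : 'I_n)
    (w : 'rV[K]_n) :
  w 0 x != 0 -> replace_row1 x w \in unitmx.
Proof.
move=> wx_neq0; apply: unitmx_annihilator => h Mh0.
have row_h a : (if a == x then w else delta_mx 0 a) *m h = 0.
  by rewrite -(rowK (fun a => if a == x then w else _)) -row_mul Mh0 row0.
have h_out a : a != x -> h a 0 = 0.
  move=> aNx; have := row_h a; rewrite (negPf aNx) -rowE.
  by move/rowP/(_ 0); rewrite !mxE.
apply/colP => a; rewrite mxE.
have [->|/h_out//] := eqVneq a x.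
have := row_h x; rewrite eqxx => /rowP/(_ 0); rewrite !mxE (bigD1 x) //=.
rewrite big1 ?addr0 => [/eqP|b /h_out->]; last by rewrite mulr0.
by rewrite mulf_eq0 (negPf wx_neq0) => /eqP.
Qed.

(** The functional [p] times coordinate [b] minus [q] times coordinate [c] kills a basis, hence is
    zero. *)
Lemma basis_coord_relation (K : fieldType) (n : nat) (X : n.-tuple 'rV[K]_n)
    (b c : 'I_n) (p q : K) :
  basis_of fullv X -> b != c ->
  (forall i, p * tnth X i 0 b = q * tnth X i 0 c) -> p = 0 /\ q = 0.
Proof.
move=> bX bNc pqX.
have /colP h0 : p *: delta_mx b 0 - q *: delta_mx c 0 = 0 :> 'cV[K]_n.
  apply: (basis_annihilator bX) => i.
  rewrite mulmxBr -!scalemxAr -!colE; apply/colP => k; rewrite [k]ord1.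
  by rewrite !mxE pqX subrr.
move: (h0 b) (h0 c); rewrite !mxE !eqxx [c == b]eq_sym (negPf bNc) /=.
by rewrite !mulr0 !mulr1 subr0 sub0r => -> /eqP; rewrite oppr_eq0 => /eqP.
Qed.

Theorem theorem2p3 (n : nat) (K : fieldType) (n_gt2 : (2 < n)%N)
    (n_odd : odd n)
    (prim_roots : forall m : nat, odd m -> (m <= n)%N ->
       exists z : K, m.-primitive_root z) :
  ~ OBC K n.
Proof.
(* From here [n] is the original dimension minus 2, the number of rows in which the standard basis
   is played. *)
case: n => [|[|n]] // in n_gt2 n_odd prim_roots *.
move=> [f fP].
pose last1 : 'I_n.+2 := ord_max.
pose last2 : 'I_n.+2 := Ordinal (leqnSn n.+1).
pose std := basis_of_unitmx (unitmx1 K n.+2).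
have stdE a b : basis_vec std a 0 b = (a == b)%:R.
  by rewrite basis_vec_unitmx !mxE.
(* The replies to an all-standard play; they form a Latin square since a basis has no repeated
   vector. *)
pose sigma i := f i (prefix_upto (fun=> std) i).
have sigma_inj j : injective (sigma^~ j).
  move=> i i' /= eq_sigma; have := fP (fun=> std) j.
  move/basis_free/free_uniq/tuple_uniqP; apply.
  by rewrite !tnth_mktuple -!/(sigma _) eq_sigma.
pose alpha := sigma last2; pose beta := sigma last1.
pose rho := (alpha^-1 * beta)%g.
have rho_alpha j : rho (alpha j) = beta j by rewrite permM permK.
have rho_neq j : rho (alpha j) != alpha j.
  rewrite rho_alpha; apply/eqP => /sigma_inj/(congr1 val) /= /eqP.
  by rewrite -[X in _ == X]addn0 -addn1 eqn_add2l.
have [x odd_m] : exists x, odd #|porbit rho x|.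
  by apply: odd_porbit_exists; rewrite card_ord.
have [z z_prim] : exists z : K, #|porbit rho x|.-primitive_root z.
  by apply: prim_roots; rewrite // -[X in (_ <= X)%N]card_ord max_card.
pose F := basis_of_unitmx (orbit_fourier_unitmx z_prim).
pose B L i := if i == last2 then F else if i == last1 then L else std.
have B_last2 L : B L last2 = F by rewrite /B eqxx.
have B_last1 L : B L last1 = L.
  by rewrite /B ifN ?eqxx //; apply/eqP => /(congr1 val) /= /esym /n_Sn.
have B_lt L (i : 'I_n.+2) : (i < n)%N -> B L i = std.
  by rewrite /B; case: eqP => [->|_]; last case: eqP => [->|_] //=;
    rewrite ltnNge ?leqnn ?leqnSn.
(* This reply precedes the last row, so it is the same for every [L]. *)
pose tau := f last2 (prefix_upto (B std) last2).
(* In column [j] the standard rows vanish at coordinates [alpha j] and [beta j], so a relation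
   between these two need only be checked on the last two rows. *)
have columnP L j p q (pi := f last1 (prefix_upto (B L) last1)) :
    p * basis_vec F (tau j) 0 (rho (alpha j)) =
      q * basis_vec F (tau j) 0 (alpha j) ->
    p * basis_vec L (pi j) 0 (rho (alpha j)) =
      q * basis_vec L (pi j) 0 (alpha j) ->
    p = 0 /\ q = 0.
  move=> Frel Lrel; apply: (basis_coord_relation (fP (B L) j) (rho_neq j)) => i.
  rewrite !tnth_mktuple.
  have [->|iN2] := eqVneq i last2.
    rewrite B_last2 (@eq_prefix_upto _ _ (B L) (B std) last2) // => k k_le.
    rewrite /B; case: ifP => // _; case: ifP => // /eqP k_last.
    by rewrite k_last /= ltnn in k_le.
  have [->|iN1] := eqVneq i last1; first by rewrite B_last1.
  have i_lt : (i < n)%N.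
    have := ltn_ord i; rewrite ltnS leq_eqVlt => /orP[/eqP eq_i|].
      by case/eqP: iN1; apply: val_inj.
    rewrite ltnS leq_eqVlt => /orP[/eqP eq_i|//].
    by case/eqP: iN2; apply: val_inj.
  rewrite (@eq_prefix_upto _ _ (B L) (fun=> std) i) => [|k k_le]; last first.
    exact/B_lt/(leq_ltn_trans k_le).
  rewrite B_lt // -/(sigma i) !stdE rho_alpha.
  rewrite /alpha /beta !(inj_eq (@sigma_inj j)) (negPf iN2) (negPf iN1).
  by rewrite !mulr0.
have FE a b : basis_vec F a 0 b = orbit_fourier rho x z a b.
  by rewrite basis_vec_unitmx mxE.
have rho_orbit b : b \in porbit rho x -> rho b \in porbit rho x.
  by move=> /iter_orbit_index <-; rewrite -iterS iter_in_porbit.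
have tau_orbit j : alpha j \in porbit rho x -> tau j \in porbit rho x.
  move=> jO; apply: contraT => tauNO.
  have F0 b : b \in porbit rho x -> basis_vec F (tau j) 0 b = 0.
    move=> bO; rewrite FE mxE (negPf tauNO); case: eqP => // tau_b.
    by rewrite tau_b bO in tauNO.
  (* With [std] as last row, one of the two coordinates vanishes throughout the column; which one
     depends on [pi j]. *)
  pose pi := f last1 (prefix_upto (B std) last1).
  have [pi_a|pi_a] := eqVneq (pi j) (alpha j).
    have [] := @columnP std j 1 0.
    - by rewrite !F0 ?rho_orbit // !mulr0.
    - by rewrite !stdE -/pi pi_a eq_sym (negPf (rho_neq j)) mulr0 mul0r.
    - by move/eqP; rewrite oner_eq0.
  have [] := @columnP std j 0 1.
  - by rewrite !F0 ?rho_orbit // !mulr0.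
  - by rewrite !stdE -/pi (negPf pi_a) mulr0 mul0r.
  - by move=> _ /eqP; rewrite oner_eq0.
(* The index of the vector of [F] placed in the column whose [alpha] entry is [b]. *)
pose g b := tau ((alpha^-1)%g b).
have g_inj : injective g by move=> b c /perm_inj/perm_inj.
have gO b : b \in porbit rho x -> g b \in porbit rho x.
  by move=> bO; apply: tau_orbit; rewrite permKV.
have [w [wx w_rho]] :=
  orbit_recurrence_solution odd_m (prim_expr_order z_prim) g_inj gO.
have wx_neq0 : w 0 x != 0 by rewrite wx oner_neq0.
pose L := basis_of_unitmx (replace_row1_unitmx wx_neq0).
pose pi := f last1 (prefix_upto (B L) last1).
(* Both [w] and every [e_c] with [c] off the orbit lie in the hyperplane of this column; its
   coefficient is the ratio of the entries of [F] at [rho b] and [b]. *)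
have pi_good b : b \in porbit rho x ->
    pi ((alpha^-1)%g b) \in porbit rho x :\ x.
  move=> bO; apply: contraT => pi_bad.
  have [] := @columnP L ((alpha^-1)%g b) 1 (z ^+ orbit_index rho x (g b)).
  - rewrite !permKV !FE !mxE -/(g b) gO // rho_orbit // bO mul1r -exprD.
    rewrite -mulnS -(prim_expr_mod z_prim) orbit_indexS // modnMmr.
    by rewrite (prim_expr_mod z_prim).
  - rewrite -/pi !permKV !basis_vec_unitmx !rowK mul1r.
    case: eqP => [_|/eqP piNx]; first by rewrite w_rho.
    move: pi_bad; rewrite !inE piNx /= => piNO.
    have out c : c \in porbit rho x -> (c == pi ((alpha^-1)%g b)) = false.
      by move=> cO; apply: contraNF piNO => /eqP <-.
    by rewrite !mxE !out ?rho_orbit // mulr0.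
  - by move/eqP; rewrite oner_eq0.
have pi_inj : injective (fun b => pi ((alpha^-1)%g b)).
  by move=> b c /perm_inj/perm_inj.
(* Pigeonhole: m columns would need distinct vectors among m - 1. *)
have : (#|porbit rho x| <= #|porbit rho x :\ x|)%N.
  rewrite -(card_imset _ pi_inj); apply: subset_leq_card.
  by apply/subsetP => _ /imsetP[b /pi_good ? ->].
by rewrite [X in (X <= _)%N](cardsD1 x) porbit_id ltnn.
Qed.
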